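(* Let $Z=(Z_n)_n$ be a recurrent one-dimensional random walk in the random environment $\omega=(\omega_x)_{x\in\mathbb Z}$. Then, for $\mathsf P$-almost every environment $\omega$, $$\sum_{n\ge1}\frac{P_\omega^0[Z_n=0]}{n}<\infty.$$
   Context: On a probability space $(\Omega,\mathcal F,\mathsf P)$ (expectation $\mathsf E$), $\omega=(\omega_x)_{x\in\mathbb Z}$ is a collection of i.i.d. random variables with values in $(0,1)$. With $\rho_k=(1-\omega_k)/\omega_k$, assume there is $\varepsilon_0\in(0,1/2)$ such that $\mathsf P[\omega_0\in[\varepsilon_0,1-\varepsilon_0]]=1$, $\mathsf E[\log\rho_0]=0$ and $\mathsf E[(\log\rho_0)^2]>0$. For fixed $\omega$, under $P_\omega^0$, $Z$ is the Markov chain on $\mathbb Z$ with $Z_0=0$ and $P_\omega^0[Z_{n+1}=y+1\mid Z_n=y]=\omega_y=1-P_\omega^0[Z_{n+1}=y-1\mid Z_n=y]$ for $y\in\mathbb Z$, $n\in\mathbb N$. *)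

(* Defs.v *)
From HB Require Import structures.
From mathcomp Require Export all_boot all_order all_algebra.
From mathcomp Require Export all_classical all_reals all_analysis.
Export Order.TTheory GRing.Theory Num.Theory.
Export numFieldNormedType.Exports.

Set Implicit Arguments.
Unset Strict Implicit.
Unset Printing Implicit Defensive.

Local Open Scope classical_set_scope.
Local Open Scope ring_scope.

Definition mutually_independent (R : realType) (d : measure_display)
    (Omega : measurableType d) (P : probability Omega R) (I : eqType)
    (X : I -> {RV P >-> R}) : Prop :=
  forall (s : seq I) (B : I -> set R),
    uniq s -> (forall i, measurable (B i)) ->
    P [set t | forall i, i \in s -> B i (X i t)]
    = (\prod_(i <- s) P (X i @^-1` B i))%E.

Definition identically_distributed (R : realType) (d : measure_display)
    (Omega : measurableType d) (P : probability Omega R) (I : Type)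
    (X : I -> {RV P >-> R}) : Prop :=
  forall (i j : I) (B : set R), measurable B ->
    distribution P (X i) B = distribution P (X j) B.

Definition rho (R : realType) (u : R) : R := (1 - u) / u.

Definition rwre_step (R : realType) (w : int -> R) (y z : int) : R :=
  if z == y + 1 then w y else if z == y - 1 then 1 - w y else 0.

(* The Markov property is given in product form, so that no conditional
   probability given a null event occurs:
   Q[Z_0 = x_0, ..., Z_(n+1) = x_(n+1)]
     = Q[Z_0 = x_0, ..., Z_n = x_n] * p(x_n, x_(n+1)).
   Since int is countable, measurability of each Z_n is required on
   singletons. *)
Definition markov_chain (R : realType) (d : measure_display)
    (T : measurableType d) (Q : probability T R) (p : int -> int -> R)
    (x0 : int) (Z : nat -> T -> int) : Prop :=
  [/\ forall (n : nat) (y : int), measurable (Z n @^-1` [set y]),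
      Q [set z | Z 0%N z = x0] = 1%E
    & forall (n : nat) (x : nat -> int),
        Q [set z | forall k : nat, (k <= n.+1)%N -> Z k z = x k]
        = (Q [set z | forall k : nat, (k <= n)%N -> Z k z = x k]
           * (p (x n) (x n.+1))%:E)%E].

(* Main.v *)
From HB Require Import structures.
Require Import Defs.
From mathcomp Require Import measurable_realfun ring lra zify.

(* Let V be the potential of the environment on the half-line,
   V(y) = sum_(1 <= i <= y) ln rho_i.  The expected net number of crossings of
   an edge before time N is at most 1; weighting this by exp V and telescoping
   bounds the Green function at 0, for every x >= 0, by
     w_0 sum_(n < N) P(Z_n = 0) <= sum_(y < x) exp V(y) + N exp V(x).
   By dyadic decomposition the series converges as soon as, for all large s,
   V falls below -s ln 8 within 32^s steps and before exceeding 4^s ln 2.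
   V is a centred random walk with steps bounded by K and of variance v; optional
   stopping of V and V^2 at the exit from ]-h, b[ shows that V fails to leave
   this interval through -h within N steps with probability at most
   (h + K) / b + (h + b + K)^2 / (v N).  At scale s this is O(2^-s), and
   Borel-Cantelli concludes. *)

Set Implicit Arguments.
Unset Strict Implicit.
Unset Printing Implicit Defensive.

Local Open Scope classical_set_scope.
Local Open Scope ring_scope.

(** * Markov chains on the integers *)

Lemma countable_bigcup_measurable {d : measure_display} {T : measurableType d}
    {I : countType} (D : set I) (F : I -> set T) :
  (forall i, D i -> measurable (F i)) -> measurable (\bigcup_(i in D) F i).
Proof.
move=> mF; rewrite bigcup_mkcond.
apply: countable_bigcupT_measurable => [|i]; first exact: countableP.
by case: ifPn => // /set_mem /mF.
Qed.

Section int_fibers.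
Context {R : realType} {d : measure_display} {T : measurableType d}.
Variables (Q : probability T R) (X : T -> int).
Hypothesis mX : forall y, measurable (X @^-1` [set y]).

Lemma measurable_preimage_int (A : set int) : measurable (X @^-1` A).
Proof.
rewrite [X in measurable X](_ : _ =
  \bigcup_(y in A) (X @^-1` [set y])); last first.
  apply/seteqP; split=> [z Az|z [y Ay /= Xz]]; last by rewrite /preimage/= Xz.
  by exists (X z).
exact: countable_bigcup_measurable.
Qed.

(** Total probability over the countably many values of [X]. It removes one coordinate at a time
    from an identity between path events; [c = 0] serves for null events. *)
Lemma fiberwise_proportional (E1 E2 : set T) (c : R) : 0 <= c ->
    measurable E1 -> measurable E2 ->
    (forall y, Q (E1 `&` X @^-1` [set y]) = (Q (E2 `&` X @^-1` [set y]) * c%:E)%E) ->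
  Q E1 = (Q E2 * c%:E)%E.
Proof.
move=> c0 mE1 mE2 E12.
(* Fibres are indexed by the codes of integers; a natural number that codes no integer gives an
   empty fibre, which contributes 0. *)
pose F (n : nat) := X @^-1` [set y | pickle y = n].
have mF n : measurable (F n) by exact: measurable_preimage_int.
have tF (E : set T) : trivIset setT (fun n => E `&` F n).
  apply/trivIsetP => i j _ _ ij; rewrite -subset0 => z [[_ /= Fi] [_ /= Fj]].
  by rewrite -Fi -Fj eqxx in ij.
have QE (E : set T) : measurable E -> Q E = (\sum_(n <oo) Q (E `&` F n))%E.
  move=> mE; rewrite -measure_semi_bigcup//; last 2 first.
  - by move=> n; exact: measurableI.
  - by apply: bigcupT_measurable => n; exact: measurableI.
  congr (Q _); apply/seteqP; split=> [z Ez|z [n _ []]//].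
  by exists (pickle (X z)).
rewrite (QE _ mE1) (QE _ mE2) muleC -nneseriesZl//.
apply: eq_eseriesr => n _; rewrite muleC /F.
case E : (pickle_inv n : option int) => [y|].
- have -> : [set y' : int | pickle y' = n] = [set y]; last exact: E12.
  apply/seteqP; split => [y' /= y'n|_ /= ->].
    by move: E; rewrite -y'n pickleK_inv => -[].
  by have := @pickle_invK int n; rewrite /oapp E.
- rewrite (_ : [set y : int | pickle y = n] = set0); last first.
    by rewrite -subset0 => y /= yn; move: E; rewrite -yn pickleK_inv.
  by rewrite preimage_set0 !setI0 measure0 mul0e.
Qed.

End int_fibers.

Section flux.
Context {R : realType} {d : measure_display} {T : measurableType d}.
Variables (Q : probability T R) (p : int -> int -> R) (x0 : int).
Variable Z : nat -> T -> int.
Hypothesis p0 : forall a b, 0 <= p a b.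
Hypothesis ZQ : markov_chain Q p x0 Z.

Let mZ n y : measurable (Z n @^-1` [set y]).
Proof. by case: ZQ. Qed.

Let cylinder (k m : nat) (x : nat -> int) :=
  [set z | forall j, (k <= j <= m)%N -> Z j z = x j].

Let measurable_cylinder k m x : measurable (cylinder k m x).
Proof.
rewrite [X in measurable X](_ : _ =
  \bigcap_(j in [set j | (k <= j <= m)%N]) (Z j @^-1` [set x j])).
  by apply: bigcap_measurableType => j _.
by apply/seteqP; split => z /= h j; exact: h.
Qed.

(** Induction on the first prescribed time [k]: the product form of the Markov property is the case
    [k = 0], and summing over the value of [Z k] frees that coordinate. As [k <= n], time [n] stays
    prescribed and the factor is the same in every term. *)
Let cylinder_step k n x : (k <= n)%N ->
  Q (cylinder k n.+1 x) = (Q (cylinder k n x) * (p (x n) (x n.+1))%:E)%E.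
Proof.
elim: k x => [|k IH] x kn.
  by case: ZQ => _ _ /(_ n x).
apply: (@fiberwise_proportional _ _ _ _ (Z k)) => // y.
pose x' j := if j == k then y else x j.
have E m : (k < m)%N -> cylinder k.+1 m x `&` Z k @^-1` [set y] = cylinder k m x'.
  move=> km; apply/seteqP; split => [z [/= xz yz] j /andP[kj jm]|z /= xz].
    rewrite /x'; case: eqVneq => [->//|jk]; apply: xz.
    by rewrite jm andbT ltn_neqAle eq_sym jk.
  split; last by rewrite /preimage/= xz /x' ?eqxx ?leqnn ?(ltnW km).
  move=> j /andP[kj jm]; rewrite xz ?jm ?(ltnW kj)//.
  by rewrite /x' gtn_eqF.
rewrite !E ?ltnS//; last by rewrite ltnW.
rewrite (IH x') ?(ltnW kn)// /x' (gtn_eqF kn) gtn_eqF//.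
by rewrite ltnS ltnW.
Qed.

Lemma markov_chain_step n a b :
  Q [set z | Z n z = a /\ Z n.+1 z = b] =
  (Q (Z n @^-1` [set a]) * (p a b)%:E)%E.
Proof.
pose x j := if (j <= n)%N then a else b.
have xn : x n = a by rewrite /x leqnn.
have xn1 : x n.+1 = b by rewrite /x ltnn.
have := cylinder_step x (leqnn n); rewrite xn xn1 => Qx.
transitivity (Q (cylinder n n.+1 x)); last first.
  rewrite Qx; congr (Q _ * _)%E.
  apply/seteqP; split => [z /= h|z /= za j]; first by rewrite /preimage/= h ?leqnn.
  by rewrite -eqn_leq => /eqP <-; rewrite xn.
congr (Q _); apply/seteqP; split => [z /= [za zb] j|z /= h].
  move=> /andP[nj]; rewrite leq_eqVlt => /predU1P[->|]; first by rewrite xn1.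
  rewrite ltnS => jn; have -> : j = n by apply/eqP; rewrite eqn_leq jn.
  by rewrite xn.
by rewrite !h ?leqnn ?xn ?xn1 ?leqnSn.
Qed.

(** Each pair in [A] has probability 0 by the one-step formula, and there are countably many pairs.
    For the walk, this discards the steps that do not lead to a nearest neighbour. *)
Lemma markov_chain_null n (A : set (int * int)) :
    (forall a b, A (a, b) -> p a b = 0) ->
  Q [set z | A (Z n z, Z n.+1 z)] = 0.
Proof.
move=> pA.
have mA a b : measurable [set z | Z n z = a /\ Z n.+1 z = b].
  exact: measurableI (mZ n a) (mZ n.+1 b).
have mE : measurable [set z | A (Z n z, Z n.+1 z)].
  rewrite [X in measurable X](_ : _ = \bigcup_(ab in A)
     [set z | Z n z = ab.1 /\ Z n.+1 z = ab.2]).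
    by apply: countable_bigcup_measurable => -[a b] _; exact: mA.
  apply/seteqP; split => [z /= Az|z [[a b] Aab [/= za zb]]]/=; last by rewrite za zb.
  by exists (Z n z, Z n.+1 z).
(* Seeing 0 as a multiple with factor 0 allows the value of [Z n], then that of [Z n.+1], to be
   fixed. *)
rewrite -[RHS](mule0 (Q setT)).
apply: (fiberwise_proportional (X := Z n)) => // a.
apply: (fiberwise_proportional (X := Z n.+1)) => //; try exact: measurableI.
move=> b; rewrite mule0; have [Aab|nAab] := pselect (A (a, b)).
  apply/eqP; rewrite -measure_le0.
  apply: (@le_trans _ _ (Q [set z | Z n z = a /\ Z n.+1 z = b])).
    apply: le_measure; rewrite ?inE//; last by move=> z [[]].
    by apply: measurableI => //; exact: measurableI.
  by rewrite markov_chain_step pA// mule0.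
rewrite (_ : _ `&` _ = set0) ?measure0//.
by rewrite -subset0 => z [[/= Az za] zb]; apply: nAab; rewrite -za -zb.
Qed.

End flux.

(** * The potential and the Green function at 0 *)

Definition potential (R : realType) (w : int -> R) (y : nat) : R :=
  \sum_(1 <= i < y.+1) ln (rho (w i%:Z)).

Section green.
Context {R : realType} {d : measure_display} {T : measurableType d}.
Variables (Q : probability T R) (w : int -> R) (x0 : int).
Variable Z : nat -> T -> int.
Hypothesis w01 : forall x, 0 < w x < 1.
Hypothesis ZQ : markov_chain Q (rwre_step w) x0 Z.

Let mZ n y : measurable (Z n @^-1` [set y]).
Proof. by case: ZQ. Qed.

Let step_ge0 a b : 0 <= rwre_step w a b.
Proof.
have /andP[w0 w1] := w01 a.
by rewrite /rwre_step; case: ifP => _; [lra|case: ifP => _; lra].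
Qed.

Let u n y := fine (Q (Z n @^-1` [set y])).

(** Mass balance across the edge from [y] to [y + 1]: outside a null event, a walk that crosses
    upwards at step [n], or is above [y] before it, either crosses downwards or is above [y] after
    it. *)
Let flux_step n y :
  u n y * w y + fine (Q [set z | y < Z n z]) <=
  u n (y + 1) * (1 - w (y + 1)) + fine (Q [set z | y < Z n.+1 z]).
Proof.
have mA m (A : set int) : measurable [set z | A (Z m z)].
  exact: measurable_preimage_int.
have mE a b : measurable [set z | Z n z = a /\ Z n.+1 z = b].
  exact: measurableI (mZ n a) (mZ n.+1 b).
pose up := [set z | Z n z = y /\ Z n.+1 z = y + 1].
pose down := [set z | Z n z = y + 1 /\ Z n.+1 z = y].
pose jump := [set ab : int * int | rwre_step w ab.1 ab.2 = 0].
pose J := [set z | jump (Z n z, Z n.+1 z)].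
have mJ : measurable J.
  rewrite [X in measurable X](_ : _ = \bigcup_(ab in jump)
     [set z | Z n z = ab.1 /\ Z n.+1 z = ab.2]).
    by apply: countable_bigcup_measurable => -[a b] _; exact: mE.
  apply/seteqP; split => [z /= Az|z [[a b] Aab [/= za zb]]]; last by rewrite /J /= za zb.
  by exists (Z n z, Z n.+1 z).
have QJ : Q J = 0 by apply: (markov_chain_null step_ge0 ZQ).
have Qup : Q up = (Q (Z n @^-1` [set y]) * (w y)%:E)%E.
  by rewrite (markov_chain_step step_ge0 ZQ) /rwre_step eqxx.
have Qdown : Q down = (Q (Z n @^-1` [set (y + 1)%R]) * (1 - w (y + 1))%:E)%E.
  rewrite (markov_chain_step step_ge0 ZQ) /rwre_step addrK eqxx.
  by case: eqP => //; lia.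
have : (Q up + Q [set z | (y < Z n z)%R] <= Q down + Q [set z | (y < Z n.+1 z)%R])%E.
  (* The two events on the left are disjoint, so their probabilities add up; on the right
     subadditivity is enough. *)
  rewrite -measureU//; last 3 first.
  - exact: mE.
  - exact: (mA n [set v | y < v]).
  - by rewrite -subset0 => z [[/= -> _]]; rewrite ltxx.
  apply: (@le_trans _ _ (Q ((down `|` [set z | y < Z n.+1 z]) `|` J))).
    apply: le_measure; rewrite ?inE.
    + by apply: measurableU; [exact: mE|exact: (mA n [set v | y < v])].
    + apply: measurableU => //; apply: measurableU; first exact: mE.
      exact: (mA n.+1 [set v | y < v]).
    + move=> z; rewrite /up /down /J /jump /=.
      case: (boolP (y < Z n.+1 z)) => h; first by left; right.
      case => [[_ e]|h']; first by rewrite e ltrDl in h.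
      have [e1|e1] := eqVneq (rwre_step w (Z n z) (Z n.+1 z)) 0; first by right.
      left; left; move: e1 h h'; rewrite /rwre_step -leNgt => e1 h h'.
      move: e1 h h'; move: (Z n z) (Z n.+1 z) => a b.
      have [->|_] := eqVneq b (a + 1); first lia.
      have [->|_] := eqVneq b (a - 1); last by rewrite eqxx.
      by move=> _ h h'; split; lia.
  rewrite measureU0//; last first.
    by apply: measurableU; [exact: mE|exact: (mA n.+1 [set v | y < v])].
  by apply: measureU2; [exact: mE|exact: (mA n.+1 [set v | y < v])].
have fin (A : set T) : measurable A -> Q A = (fine (Q A))%:E.
  by move=> mB; rewrite fineK// fin_num_measure.
have f1 := fin _ (mA n [set v | y < v]).
have f2 := fin _ (mA n.+1 [set v | y < v]).
rewrite Qup Qdown f1 f2 /u (fin (Z n @^-1` [set y]))//.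
by rewrite (fin (Z n @^-1` [set (y + 1)%R])).
Qed.

Definition green (N : nat) (y : int) : R := \sum_(n < N) u n y.

(** When [flux_step] is summed over time, the probabilities of being above [y] telescope and leave
    at most 1. *)
Let green_flux N y :
  green N y * w y <= green N (y + 1) * (1 - w (y + 1)) + 1.
Proof.
suff : green N y * w y <=
    green N (y + 1) * (1 - w (y + 1)) + fine (Q [set z | y < Z N z]).
  move/le_trans; apply; rewrite lerD2l.
  have mE : measurable [set z | y < Z N z].
    exact: (measurable_preimage_int (X := Z N) _ [set v | y < v]).
  by rewrite -lee_fin fineK ?fin_num_measure// probability_le1.
rewrite /green; elim: N => [|N IH].
  by rewrite !big_ord0 !mul0r add0r fine_ge0.
rewrite !big_ord_recr/=; have := flux_step N y; lra.
Qed.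

Let green_ge0 N y : 0 <= green N y.
Proof. by apply: sumr_ge0 => n _; exact: fine_ge0. Qed.

Let green_le N y : green N y <= N%:R.
Proof.
rewrite -[N in leRHS]card_ord -sum1_card natr_sum; apply: ler_sum => n _.
by rewrite -lee_fin fineK ?fin_num_measure// probability_le1.
Qed.

(** As [rho w = 1 - w] at each site, multiplying [green_flux] by [exp V(x)] gives [exp V(x) w_x G(x)
    <= exp V(x) + exp V(x+1) w_(x+1) G(x+1)]. This is iterated from 0, and the last term is bounded
    by [G <= N]. *)
Lemma green_le_potential N x :
  green N 0 * w 0 <=
  \sum_(y < x) expR (potential w y) + expR (potential w x) * N%:R.
Proof.
have w0 y : 0 < w y by case/andP: (w01 y).
suff : green N 0 * w 0 <= \sum_(y < x) expR (potential w y) +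
    expR (potential w x) * (green N x * w x).
  move/le_trans; apply; rewrite lerD2l ler_pM2l ?expR_gt0//.
  apply: le_trans (green_le N x); rewrite ler_piMr ?green_ge0//.
  by case/andP: (w01 x) => _ /ltW.
elim: x => [|x /le_trans].
  by rewrite big_ord0 /potential big_geq// expR0 add0r mul1r.
apply; rewrite big_ord_recr/= -addrA lerD2l.
have -> : potential w x.+1 = potential w x + ln (rho (w x.+1)).
  by rewrite /potential big_nat_recr.
have rho_gt0 : 0 < rho (w x.+1).
  by rewrite divr_gt0 ?subr_gt0//; case/andP: (w01 x.+1).
rewrite expRD lnK ?posrE// -[X in X + _]mulr1 -mulrA -mulrDr ler_pM2l ?expR_gt0//.
have -> : rho (w x.+1) * (green N x.+1 * w x.+1) = green N x.+1 * (1 - w x.+1).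
  by rewrite /rho; field; rewrite gt_eqF.
have := green_flux N x; have -> : x%:Z + 1 = x.+1 by lia.
lra.
Qed.

End green.

(** * Dyadic summation *)

Section blocks.
Context {R : realType}.
Implicit Types f u : nat -> R.

Lemma sum_blocks f (a : nat -> nat) m n : (m <= n)%N ->
    (forall i, a i <= a i.+1)%N ->
  \sum_(a m <= k < a n) f k = \sum_(m <= s < n) \sum_(a s <= k < a s.+1) f k.
Proof.
move=> mn a_nd; rewrite -(subnKC mn); elim: (n - m)%N => [|j IH].
  by rewrite addn0 !big_geq.
rewrite addnS big_nat_recr ?leq_addr//= -IH -big_cat_nat//.
by elim: j {IH} => [|j IH]; rewrite ?addn0// addnS (leq_trans IH).
Qed.

(** On the block [2^k <= n < 2^(k+1)], [1/n] is at most [2^-k]; the block is then enlarged to all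
    [n < 2^(k+1)], so that only partial sums from 0 appear. *)
Lemma dyadic_sum_le u K : (forall n, 0 <= u n) ->
  \sum_(1 <= n < 2 ^ K) u n / n%:R <=
  \sum_(0 <= k < K) (2 ^+ k)^-1 * \sum_(n < 2 ^ k.+1) u n.
Proof.
move=> u0; rewrite -[X in bigop _ (index_iota X _)](expn0 2).
rewrite (sum_blocks _ (a := expn 2))//; last by move=> i; rewrite leq_exp2l.
apply: ler_sum => k _; rewrite -[X in _ <= _ * X](big_mkord xpredT).
rewrite [X in _ <= _ * X](@big_cat_nat _ _ _ (2 ^ k)%N)//=; last by rewrite leq_exp2l.
rewrite mulrDr -[leLHS]add0r lerD//.
  by rewrite mulr_ge0 ?invr_ge0 ?exprn_ge0// sumr_ge0.
rewrite mulr_sumr; apply: ler_sum_nat => n /andP[kn _].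
rewrite mulrC ler_wpM2r// lef_pV2 ?posrE ?exprn_gt0 ?ltr0n//.
  by rewrite -natrX ler_nat.
by rewrite (leq_trans _ kn)// expn_gt0.
Qed.

Lemma sum_half_le n : \sum_(0 <= s < n) (2^-1 : R) ^+ s <= 2.
Proof.
suff -> : \sum_(0 <= s < n) (2^-1 : R) ^+ s = 2 - 2 * 2^-1 ^+ n.
  by rewrite lerBlDr lerDl mulr_ge0// exprn_ge0// invr_ge0.
elim: n => [|n IH]; first by rewrite big_geq// expr0; lra.
by rewrite big_nat_recr//= IH exprS; lra.
Qed.

Lemma eseries_lty u (C : R) m : (forall n, 0 <= u n) ->
  (forall n, \sum_(m <= k < n) u k <= C) -> (\sum_(m <= k <oo) (u k)%:E < +oo)%E.
Proof.
move=> u0 uC; apply: (@le_lt_trans _ _ C%:E); last exact: ltry.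
apply: lime_le; first by apply: is_cvg_nneseries => n _ _; rewrite lee_fin.
by apply: nearW => n; rewrite sumEFin lee_fin.
Qed.

(** Yields [32^s 2^(4^s) 2^-k <= 16 * 8^-s] for [k >= 2 * 4^s]: in exponents of 2 this reads
    [5s + 4^s + 3s <= k + 4]. *)
Lemma expn4_lower s : (8 * s <= 4 ^ s + 4)%N.
Proof.
elim: s => [//|[|[|s]] IH]//.
by move: IH; rewrite mulnS (expnS 4 s.+2) (expnS 4 s.+1) (expnS 4 s); nia.
Qed.

(* At the dyadic scales 2^k with 2 * 4^s <= k < 2 * 4^(s+1), such an x gives
   2^-k A(2^(k+1)) = O(8^-s), A being the sums of u, while there are
   6 * 4^s such scales. *)
Definition deep_valley (V : nat -> R) (s : nat) := exists2 x, (x <= 32 ^ s)%N &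
  V x <= - (s%:R * ln 8) /\ forall y, (y < x)%N -> V y <= (4 ^ s)%:R * ln 2.

(** The bound by [V] is applied with [N = 2^(k+1)] at the valley of the scale [s] whose block
    contains [k]. The blocks then contribute a geometric series, and the finitely many [k < a s0]
    are kept as a constant. *)
Lemma summable_of_valleys u (V : nat -> R) (c : R) s0 :
    (forall n, 0 <= u n) -> 0 < c ->
    (forall N x, (\sum_(n < N) u n) * c <=
       \sum_(y < x) expR (V y) + expR (V x) * N%:R) ->
    (forall s, (s0 <= s)%N -> deep_valley V s) ->
  (\sum_(1 <= n <oo) (u n / n%:R)%:E < +oo)%E.
Proof.
move=> u0 c0 uV valley.
pose a s := (2 * 4 ^ s)%N.
have a_nd s : (a s <= a s.+1)%N by rewrite /a leq_mul2l leq_exp2l ?leqnSn.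
pose al k := (2 ^+ k)^-1 * \sum_(n < 2 ^ k.+1) u n.
have al_ge0 k : 0 <= al k.
  by rewrite mulr_ge0 ?invr_ge0 ?exprn_ge0// sumr_ge0.
have al_le s k : (s0 <= s)%N -> (a s <= k)%N -> al k * c <= 18 * 8^-1 ^+ s.
  move=> s0s ask; have [x xs [Vx Vy]] := valley s s0s.
  have e8 : expR (V x) <= 8^-1 ^+ s.
    rewrite -[8^-1]lnK ?posrE ?invr_gt0// -expRM_natl ler_expR.
    by rewrite lnV ?posrE// mulrN.
  have ey : \sum_(y < x) expR (V y) <= 32 ^+ s * 2 ^+ (4 ^ s).
    apply: (@le_trans _ _ (\sum_(y < x) 2 ^+ (4 ^ s))).
      apply: ler_sum => y _; rewrite -[2]lnK ?posrE// -expRM_natl ler_expR.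
      exact: Vy.
    rewrite big_const_ord iter_addr_0 -[leLHS]mulr_natl ler_wpM2r ?exprn_ge0//.
    by rewrite -natrX ler_nat.
  rewrite /al -mulrA; apply: (@le_trans _ _ ((2 ^+ k)^-1 *
      (32 ^+ s * 2 ^+ (4 ^ s) + 8^-1 ^+ s * (2 ^ k.+1)%:R))).
    rewrite ler_wpM2l ?invr_ge0 ?exprn_ge0//.
    apply: le_trans (uV _ x) _; apply: lerD => //.
    by rewrite ler_wpM2r.
  have k2 : 2 ^+ k != 0 :> R by rewrite expf_neq0.
  (* The share 16 bounds the sum over the sites before the valley, by [expn4_lower]; the share 2 is
     [2^(k+1) / 2^k] in the term at the valley. *)
  rewrite natrX exprS mulrDr (_ : (18 : R) = 16 + 2); last by lra.
  rewrite [leRHS]mulrDl; apply: lerD; last first.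
    by rewrite le_eqVlt; apply/orP; left; apply/eqP; field.
  rewrite mulrC ler_pdivrMr ?exprn_gt0//.
  rewrite exprVn mulrAC ler_pdivlMr ?exprn_gt0//.
  have -> : 8 = 2 ^+ 3 :> R by rewrite -natrX.
  have -> : 32 = 2 ^+ 5 :> R by rewrite -natrX.
  have -> : 16 = 2 ^+ 4 :> R by rewrite -natrX.
  rewrite -!exprM -!exprD ler_eXn2l ?ltr1n//.
  have := expn4_lower s; move: ask; rewrite /a; lia.
(* Block [s] holds [6 * 4^s] values of [k], each contributing at most [18 * 8^-s / c]; hence 108 and
   the ratio 1/2. *)
have be_le s : (s0 <= s)%N ->
    \sum_(a s <= k < a s.+1) al k <= 108 / c * 2^-1 ^+ s.
  move=> s0s; rewrite mulrAC ler_pdivlMr// mulr_suml.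
  apply: (@le_trans _ _ (\sum_(a s <= k < a s.+1) 18 * 8^-1 ^+ s)).
    by apply: ler_sum_nat => k /andP[ask _]; exact: al_le.
  rewrite big_const_nat iter_addr_0 -[leLHS]mulr_natl.
  have -> : (a s.+1 - a s)%N = (6 * 4 ^ s)%N by rewrite /a expnS; lia.
  rewrite natrM natrX mulrACA -exprMn -natrM.
  by rewrite (_ : 4 * 8^-1 = 2^-1 :> R)//; lra.
apply: (@eseries_lty _ (\sum_(0 <= k < a s0) al k + 108 / c * 2)).
  by move=> n; rewrite divr_ge0.
(* With this [S], [2 ^ a S] is at least [N], and the range of [k] can be split at [a s0]. *)
move=> N; pose S := maxn s0 N.
have NS : (N <= 2 ^ a S)%N.
  apply: (leq_trans (leq_maxr s0 N)); rewrite -/S.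
  apply: ltnW; apply: (leq_trans (ltn_expl S (isT : (1 < 4)%N))).
  apply: (leq_trans (ltnW (ltn_expl _ (isT : (1 < 2)%N)))).
  by rewrite leq_exp2l// /a leq_pmull.
apply: (@le_trans _ _ (\sum_(1 <= n < 2 ^ a S) u n / n%:R)).
  have [N0|N0] := leqP N 1.
    by rewrite big_geq// sumr_ge0// => n _; rewrite divr_ge0.
  rewrite [leRHS](@big_cat_nat _ _ _ N)//=; last exact: ltnW.
  by rewrite lerDl sumr_ge0// => n _; rewrite divr_ge0.
apply: le_trans (dyadic_sum_le _ u0) _.
have aS : (a s0 <= a S)%N by rewrite leq_mul2l leq_exp2l// leq_maxl.
rewrite (@big_cat_nat _ _ _ (a s0))//= lerD2l (sum_blocks _ (leq_maxl _ _))//.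
apply: (@le_trans _ _ (\sum_(s0 <= s < S) 108 / c * 2^-1 ^+ s)).
  by apply: ler_sum_nat => s /andP[s0s _]; exact: be_le.
rewrite -mulr_sumr ler_wpM2l ?divr_ge0 ?(ltW c0)//.
apply: le_trans (sum_half_le S).
rewrite [leRHS](@big_cat_nat _ _ _ s0) ?leq_maxl//= lerDr.
by rewrite sumr_ge0// => s _; rewrite exprn_ge0// invr_ge0.
Qed.

End blocks.

(** * Independence *)

Section independence.
Context {R : realType} {d : measure_display} {Omega : measurableType d}.
Variable P : probability Omega R.

(** As functions of [D], both sides are finite measures; they agree on the rectangles, a generating
    class stable under intersection that contains the whole plane. *)
Lemma indep_rectangles (W : Omega -> R * R) (E : set Omega) :
    measurable_fun setT W -> measurable E ->
    (forall A C, measurable A -> measurable C ->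
       P (W @^-1` (A `*` C) `&` E) = (P (W @^-1` (A `*` C)) * P E)%E) ->
  forall D, measurable D -> P (W @^-1` D `&` E) = (P (W @^-1` D) * P E)%E.
Proof.
move=> mW mE h D mD.
pose Wm : {mfun Omega >-> (R * R)%type} := HB.pack W (isMeasurableFun.Build _ _ _ _ _ mW).
pose e : {nonneg R} := NngNum (fine_ge0 (measure_ge0 P E)).
pose m1 : {measure set (R * R) -> \bar R} := pushforward (mrestr P mE) Wm.
pose m2 : {measure set (R * R) -> \bar R} := mscale e (distribution P Wm).
have PE : P E = (fine (P E))%:E by rewrite fineK ?fin_num_measure.
suff : m1 mW D = m2 D.
  by rewrite /m1 /m2 /= /mscale /distribution /pushforward /mrestr /= -PE muleC.
pose G : set (set (R * R)) :=
  [set A `*` C | A in measurable & C in measurable].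
apply: (measure_unique G (fun=> setT) _ _ _ _ (m1 mW) m2) => //.
- by rewrite measurable_prod_measurableType.
- move=> _ _ [A1 mA1 [A2 mA2 <-]] [B1 mB1 [B2 mB2 <-]].
  exists (A1 `&` B1); first exact: measurableI.
  by exists (A2 `&` B2); [exact: measurableI|rewrite setXI].
- by move=> _; exists setT => //; exists setT => //; rewrite setXTT.
- by rewrite bigcup_const.
- move=> _ [A mA [C mC <-]].
  rewrite /m1 /m2 /= /mscale /distribution /pushforward /mrestr /= -PE muleC.
  exact: h.
- move=> _; rewrite /m1 /= /pushforward /mrestr preimage_setT setTI.
  by rewrite ltey_eq fin_num_measure.
Qed.

(** By uniqueness of the product measure the law of [(X, Y)] is the product of the laws; Tonelli
    then separates the integral. *)
Let indep_integral_ge0 (X Y : {mfun Omega >-> R}) :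
    (forall A C, measurable A -> measurable C ->
       P (X @^-1` A `&` Y @^-1` C) = (P (X @^-1` A) * P (Y @^-1` C))%E) ->
    (forall t, 0 <= X t) -> (forall t, 0 <= Y t) ->
  (\int[P]_t (X t * Y t)%:E = \int[P]_t (X t)%:E * \int[P]_t (Y t)%:E)%E.
Proof.
move=> XY X0 Y0.
have mW : measurable_fun setT (fun t => (X t, Y t)) by exact: measurable_fun_pair.
pose W : {mfun Omega >-> (R * R)%type} :=
  HB.pack (fun t => (X t, Y t)) (isMeasurableFun.Build _ _ _ _ _ mW).
(* the absolute values make the integrand nonnegative on all of R * R *)
pose f (z : R * R) : \bar R := (`|z.1| * `|z.2|)%:E.
have mf : measurable_fun setT f.
  apply/measurable_EFinP/measurable_funM; apply: measurableT_comp => //.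
have -> : (\int[P]_t (X t * Y t)%:E = \int[distribution P W]_z f z)%E.
  rewrite ge0_integral_distribution//.
    by apply: eq_integral => t _; rewrite /f/= !ger0_norm.
  by move=> z; rewrite lee_fin mulr_ge0.
have -> : (\int[distribution P W]_z f z =
           \int[distribution P X \x distribution P Y]_z f z)%E.
  apply: eq_measure_integral => D mD _; apply/esym.
  apply: product_measure_unique mD => A B mA mB; exact: XY.
have f0 z : (0 <= f z)%E by rewrite lee_fin mulr_ge0.
rewrite [LHS](@fubini_tonelli1 _ _ _ _ R (distribution P X) (distribution P Y) f mf f0).
rewrite /fubini_F /f/=.
have mabs : measurable_fun setT (fun x : R => `|x|%:E).
  by apply/measurable_EFinP; exact: normr_measurable.
have nrm (Z : {mfun Omega >-> R}) : (forall t, 0 <= Z t) ->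
    (\int[distribution P Z]_x `|x|%:E = \int[P]_t (Z t)%:E)%E.
  move=> Z0; rewrite ge0_integral_distribution//.
  by apply: eq_integral => t _; rewrite /= ger0_norm ?Z0.
rewrite -(nrm _ X0) -(nrm _ Y0) -ge0_integralZr//; last exact: integral_ge0.
apply: eq_integral => x _.
under eq_integral do rewrite EFinM.
by rewrite ge0_integralZl.
Qed.

Lemma integrable_of_bound (X : Omega -> R) (K : R) :
    measurable_fun setT X -> (forall t, `|X t| <= K) ->
  P.-integrable setT (EFin \o X).
Proof.
move=> mX XK; apply: measurable_bounded_integrable => //.
  by rewrite ltey_eq fin_num_measure.
exists K; split; first exact: num_real.
by move=> x Kx t _; apply: le_trans (XK t) (ltW Kx).
Qed.

(** Adding [K] makes both variables nonnegative and preserves independence; expanding the product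
    and cancelling the terms in [K] gives the claim. *)
Lemma indep_Rintegral (X Y : Omega -> R) (K : R) :
    measurable_fun setT X -> measurable_fun setT Y ->
    (forall t, `|X t| <= K) -> (forall t, `|Y t| <= K) ->
    (forall A C, measurable A -> measurable C ->
       P (X @^-1` A `&` Y @^-1` C) = (P (X @^-1` A) * P (Y @^-1` C))%E) ->
  \int[P]_t (X t * Y t) = \int[P]_t X t * \int[P]_t Y t.
Proof.
move=> mX mY XK YK XY.
have iX := integrable_of_bound mX XK.
have iY := integrable_of_bound mY YK.
have iXY : P.-integrable setT (EFin \o (fun t => X t * Y t)).
  apply: (@integrable_of_bound _ (K * K)); first exact: measurable_funM.
  by move=> t; rewrite normrM ler_pM.
have iK : P.-integrable setT (EFin \o cst K).
  by apply: (@integrable_of_bound _ `|K|) => // t.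
have iXK := integrableD measurableT iX iK.
have iYK := integrableD measurableT iY iK.
have mXK : measurable_fun setT (fun t => X t + K) by exact: measurable_funD.
have mYK : measurable_fun setT (fun t => Y t + K) by exact: measurable_funD.
pose X' : {mfun Omega >-> R} :=
  HB.pack (fun t => X t + K) (isMeasurableFun.Build _ _ _ _ _ mXK).
pose Y' : {mfun Omega >-> R} :=
  HB.pack (fun t => Y t + K) (isMeasurableFun.Build _ _ _ _ _ mYK).
have mshift (A : set R) : measurable A -> measurable ((fun x => x + K) @^-1` A).
  move=> mA; rewrite -[X in measurable X]setTI.
  by apply: (measurable_funD _ _ measurableT mA).
have : \int[P]_t (X' t * Y' t) = \int[P]_t X' t * \int[P]_t Y' t.
  rewrite /Rintegral -fineM.
  - rewrite indep_integral_ge0//.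
    + by move=> A C mA mC; exact: XY (mshift _ mA) (mshift _ mC).
    + by move=> t /=; have := XK t; rewrite ler_norml; lra.
    + by move=> t /=; have := YK t; rewrite ler_norml; lra.
  - exact: (integrable_fin_num measurableT iXK).
  - exact: (integrable_fin_num measurableT iYK).
have cK : \int[P]_t cst K t = K.
  by rewrite Rintegral_cst// [X in fine X]probability_setT mulr1.
have iXYK := integrableD measurableT iX iYK.
have -> : \int[P]_t (X' t * Y' t) =
    \int[P]_t (X t * Y t) + K * (\int[P]_t X t + (\int[P]_t Y t + K)).
  rewrite -[X in _ + (_ + X)]cK -!RintegralD// -RintegralZl// -RintegralD//; last first.
    exact: (integrableZl measurableT K iXYK).
  by apply: eq_Rintegral => t _ /=; ring.
rewrite /= !RintegralD// cK => h.
apply: (addIr (K * (\int[P]_t X t + (\int[P]_t Y t + K)))).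
by rewrite h; ring.
Qed.

End independence.

(** * Recursions driven by independent variables *)

Section autoregression.
Context {R : realType} {d : measure_display} {Omega : measurableType d}.
Variables (P : probability Omega R) (X : int -> {RV P >-> R}).
Hypothesis X_indep : mutually_independent X.
Variables (F : R * R -> R) (M : nat -> Omega -> R) (m0 : R).
Hypothesis mF : measurable_fun setT F.
Hypothesis M0 : M 0 = cst m0.
Hypothesis MS : forall n, M n.+1 = fun t => F (M n t, X n.+1 t).

Let cylinder (s : seq int) (B : int -> set R) :=
  [set t | forall i, i \in s -> B i (X i t)].

Let mX i A : measurable A -> measurable (X i @^-1` A).
Proof. by move=> mA; rewrite -[X in measurable X]setTI; exact: measurable_funP. Qed.

Let measurable_cylinder s B : (forall i, measurable (B i)) ->
  measurable (cylinder s B).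
Proof.
move=> mB; rewrite [X in measurable X](_ : _ =
    \bigcap_(i in [set` s]) (X i @^-1` B i)).
  by apply: fin_bigcap_measurable => // i _; exact: mX.
by apply/seteqP; split => t /= h i; exact: h.
Qed.

Lemma measurable_autoregression n : measurable_fun setT (M n).
Proof.
elim: n => [|n IH]; first by rewrite M0.
rewrite MS; apply: (measurableT_comp mF); exact: measurable_fun_pair.
Qed.

Let mM n A : measurable A -> measurable (M n @^-1` A).
Proof.
move=> mA; rewrite -[X in measurable X]setTI.
exact: measurable_autoregression.
Qed.

(* The other coordinates [cylinder s B] are carried along so that the induction
   goes through; only [s = [:: n.+1]] is used in the end. *)
Let autoregression_cylinder n s B A : uniq s ->
    (forall i : int, i \in s -> n%:Z < i) -> (forall i, measurable (B i)) ->
    measurable A ->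
  P (M n @^-1` A `&` cylinder s B) = (P (M n @^-1` A) * P (cylinder s B))%E.
Proof.
elim: n s B A => [|n IH] s B A us ns mB mA.
  rewrite M0 preimage_cst; case: ifPn => _.
    by rewrite setTI [X in (X * _)%E]probability_setT mul1e.
  by rewrite set0I measure0 mul0e.
have sn i : i \in s -> (i == n.+1) = false.
  by move=> /ns; case: eqP => // ->; rewrite ltxx.
have -> : M n.+1 @^-1` A = (fun t => (M n t, X n.+1 t)) @^-1` (F @^-1` A).
  by rewrite MS.
(* It suffices to treat the event that [M n] is in [C] and [X n.+1] in [D]. The latter condition
   becomes one more prescribed coordinate, and the induction hypothesis is used twice: for
   [n.+1 :: s] and for [n.+1] alone. *)
apply: indep_rectangles; first 1 last.
- exact: measurable_cylinder.
- move=> C D mC mD.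
  pose B' (i : int) : set R := if i == n.+1 then D else B i.
  have mB' i : measurable (B' i) by rewrite /B'; case: ifP.
  have us' : uniq (n.+1%:Z :: s).
    by rewrite /= us andbT; apply/negP => /ns; rewrite ltxx.
  have ns' i : i \in (n.+1%:Z :: s) -> n%:Z < i.
    by rewrite inE => /predU1P[->|/ns]; rewrite ?ltz_nat//; lia.
  have PB s' : uniq s' -> P (cylinder s' B') = (\prod_(i <- s') P (X i @^-1` B' i))%E.
    by move=> us''; exact: X_indep.
  have cylB : cylinder s B = cylinder s B'.
    apply/seteqP; split => t /= h i si; move: (h i si); by rewrite /B' sn.
  have cyl1 : cylinder [:: n.+1%:Z] B' = X n.+1 @^-1` D.
    apply/seteqP; split => t /=.
      by move=> /(_ n.+1%:Z); rewrite /B' eqxx inE eqxx; exact.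
    by move=> Dt i; rewrite inE => /eqP ->; rewrite /B' eqxx.
  have cylS : cylinder (n.+1%:Z :: s) B' = X n.+1 @^-1` D `&` cylinder s B.
    rewrite cylB -cyl1; apply/seteqP; split => t /=.
      move=> h; split=> i; last by move=> si; apply: h; rewrite inE si orbT.
      by rewrite inE => /eqP ->; apply: h; rewrite mem_head.
    by move=> [h1 h2] i; rewrite inE => /predU1P[->|/h2//]; apply: h1; rewrite mem_head.
  have -> : (fun t => (M n t, X n.+1 t)) @^-1` (C `*` D) =
      M n @^-1` C `&` cylinder [:: n.+1%:Z] B' by rewrite cyl1.
  rewrite -setIA [in LHS]cyl1 -cylS IH// IH//; last first.
    by move=> i; rewrite inE => /eqP ->; rewrite ltz_nat.
  rewrite cylB -muleA; congr (_ * _)%E.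
  by rewrite !PB// big_cons big_seq1.
- by rewrite -[X in measurable X]setTI; exact: mF.
- by apply: measurable_fun_pair => //; exact: measurable_autoregression.
Qed.

Lemma autoregression_indep n A B : measurable A -> measurable B ->
  P (M n @^-1` A `&` X n.+1 @^-1` B) =
  (P (M n @^-1` A) * P (X n.+1 @^-1` B))%E.
Proof.
move=> mA mB; have <- : cylinder [:: n.+1%:Z] (fun=> B) = X n.+1 @^-1` B.
  apply/seteqP; split => t /= h; first by apply: (h n.+1%:Z); rewrite inE.
  by move=> i; rewrite inE => /eqP ->.
apply: autoregression_cylinder => // i.
by rewrite inE => /eqP ->; rewrite ltz_nat.
Qed.

End autoregression.

(** * Exit of a centred random walk from an interval *)

(** The partial sums frozen once they leave [I]. The indicator of the current position replaces a
    stopping time, so that the next value depends only on the current one and on the next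
    increment. *)
Fixpoint stopped_sum (R : realType) (I : set R) (x : nat -> R) (n : nat) : R :=
  if n is m.+1 then stopped_sum I x m + \1_I (stopped_sum I x m) * x m.+1 else 0.

Lemma stopped_sum_exit_below (R : realType) (h b : R) (x : nat -> R) N : 0 < b ->
    stopped_sum `]- h, b[ x N <= - h ->
  exists2 y, (y <= N)%N & \sum_(1 <= i < y.+1) x i <= - h /\
    forall z, (z < y)%N -> \sum_(1 <= i < z.+1) x i <= b.
Proof.
move=> b0; set M := stopped_sum _ _ => MN.
pose S (y : nat) : R := \sum_(1 <= i < y.+1) x i.
rewrite -/(exists2 y, (y <= N)%N & S y <= - h /\ forall z, (z < y)%N -> S z <= b).
(* Invariant: the walk is not yet frozen before time [N], or it is frozen at or above [b], or its
   first passage below [- h] has already been found. The first case includes the time of exit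
   itself. *)
suff : [\/ M N = S N /\ forall z, (z < N)%N -> S z <= b,
    b <= M N /\ - h < M N | exists2 y, (y <= N)%N &
      S y <= - h /\ forall z, (z < y)%N -> S z <= b].
  case=> [[MS Sb]|[_ hM]|//]; first by exists N => //; rewrite -MS.
  by rewrite leNgt hM in MN.
elim: N {MN} => [|N IH]; first by apply: Or31; rewrite /S big_geq.
have -> : M N.+1 = M N + (- h < M N < b)%R%:R * x N.+1.
  by rewrite {1}/M /= -/(M N) indicE mem_setE in_itv.
case: IH => [[MS Sb]|[bM hM]|[y yN Sy]]; last 2 first.
- by apply: Or32; rewrite [M N < b]ltNge bM andbF mul0r addr0.
- by apply: Or33; exists y => //; exact: leqW.
have [hM|hM] := ltP (- h) (M N); last first.
  by apply: Or33; exists N => //; rewrite -MS.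
have [bM|bM] := ltP (M N) b; last by apply: Or32; rewrite mul0r addr0.
apply: Or31; rewrite mul1r; split.
  by rewrite /S MS [in RHS]big_nat_recr.
move=> z; rewrite ltnS leq_eqVlt => /predU1P[->|]; last exact: Sb.
by rewrite -MS ltW.
Qed.

Section exit.
Context {R : realType} {d : measure_display} {Omega : measurableType d}.
Variables (P : probability Omega R) (X : int -> {RV P >-> R}).
Hypothesis X_indep : mutually_independent X.
Variables (f : R -> R) (K v h b : R).
Hypothesis mf : measurable_fun setT f.
Hypothesis fK : forall u, `|f u| <= K.
Hypothesis f_mean : forall i, \int[P]_t f (X i t) = 0.
Hypothesis f_var : forall i, \int[P]_t (f (X i t) ^+ 2) = v.
Hypotheses (h0 : 0 <= h) (b0 : 0 < b) (v0 : 0 < v).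

Let I : set R := `]- h, b[.
Let M n t := stopped_sum I (fun i => f (X i%:Z t)) n.
Let xi n t := f (X (n.+1)%:Z t).
Let D n t : R := \1_I (M n t).

Let K0 : 0 <= K.
Proof. exact: le_trans (normr_ge0 _) (fK 0). Qed.

Let D01 n t : 0 <= D n t <= 1.
Proof. by rewrite /D indicE; case: (_ \in _); rewrite ?lexx ?ler01. Qed.

Let DE n t : D n t = (- h < M n t < b)%R%:R.
Proof. by rewrite /D indicE mem_setE in_itv. Qed.

Let MS n t : M n.+1 t = M n t + D n t * xi n t.
Proof. by []. Qed.

(** The last step before freezing starts inside the interval, so it overshoots by at most [K]. *)
Let M_bound n t : - (h + K) <= M n t <= b + K.
Proof.
elim: n => [|n IH]; first by rewrite /M/=; have := K0; move: h0 b0; lra.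
rewrite MS DE; have := fK (X n.+1 t); rewrite -/(xi n t) ler_norml.
case: (boolP (_ < _ < _)) => [|_]; first by rewrite mul1r; lra.
by rewrite mul0r addr0.
Qed.

Let L := h + b + K.

Let M_norm n t : `|M n t| <= L.
Proof. by have := M_bound n t; rewrite ler_norml /L; move: h0 b0; lra. Qed.

Let mI : measurable I. Proof. exact: measurable_itv. Qed.

Let mI1 : measurable_fun setT (\1_I : R -> R).
Proof. exact: measurable_indic. Qed.

Let F (z : R * R) : R := z.1 + \1_I z.1 * f z.2.

Let mF : measurable_fun setT F.
Proof.
apply: measurable_funD => //; apply: measurable_funM.
  exact: (measurableT_comp mI1).
exact: measurableT_comp.
Qed.

Let mM n : measurable_fun setT (M n).
Proof. exact: (measurable_autoregression (F := F) (m0 := 0)). Qed.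

Let mD n : measurable_fun setT (D n).
Proof. exact: (measurableT_comp mI1). Qed.

Let mxi n : measurable_fun setT (xi n).
Proof. exact: measurableT_comp. Qed.

Let E_indep n (g k : R -> R) C : measurable_fun setT g -> measurable_fun setT k ->
    (forall t, `|g (M n t)| <= C) -> (forall t, `|k (X n.+1 t)| <= C) ->
  \int[P]_t (g (M n t) * k (X n.+1 t)) =
  \int[P]_t g (M n t) * \int[P]_t k (X n.+1 t).
Proof.
move=> mg mk gC kC; apply: (@indep_Rintegral _ _ _ _ _ _ C) => //.
- exact: measurableT_comp.
- exact: measurableT_comp.
move=> A B mA mB.
have mgA : measurable (g @^-1` A) by rewrite -[X in measurable X]setTI; exact: mg.
have mkB : measurable (k @^-1` B) by rewrite -[X in measurable X]setTI; exact: mk.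
exact: (@autoregression_indep _ _ _ P X X_indep F M 0 mF _ _ n _ _ mgA mkB).
Qed.

Let iD n : P.-integrable setT (EFin \o D n).
Proof.
apply: (@integrable_of_bound _ _ _ P (D n) 1) => // t.
by have /andP[d0 d1] := D01 n t; rewrite ger0_norm.
Qed.

Let iM n : P.-integrable setT (EFin \o M n).
Proof. exact: integrable_of_bound (M_norm n). Qed.

Let iM2 n : P.-integrable setT (EFin \o (fun t => M n t ^+ 2)).
Proof.
apply: (@integrable_of_bound _ _ _ P (fun t => M n t ^+ 2) (L ^+ 2)) => [|t].
  exact: measurable_funX.
by rewrite normrX lerXn2r ?nnegrE// (le_trans _ (M_norm n t)).
Qed.

Let E_M n : \int[P]_t M n t = 0.
Proof.
elim: n => [|n IH]; first by rewrite /M/= Rintegral_cst// mul0r.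
under eq_Rintegral do rewrite MS.
have DK t : `|D n t| <= 1 + K.
  have := D01 n t; have := K0; rewrite ler_norml; lra.
have xiK t : `|xi n t| <= 1 + K by apply: le_trans (fK _) _; rewrite lerDr.
rewrite RintegralD//; last first.
  apply: (@integrable_of_bound _ _ _ P (fun t => D n t * xi n t)
    ((1 + K) * (1 + K))) => [|t].
    exact: measurable_funM.
  by rewrite normrM ler_pM.
rewrite IH add0r (E_indep (g := \1_I) (k := f) (C := 1 + K))//.
by rewrite f_mean mulr0.
Qed.

(** Since [D] is an indicator, [M^2] grows by [2 D M xi + D xi^2]. The new increment [xi] is
    independent of [M n] and centred, so the cross term has mean 0 and the other one has mean [v]
    times that of [D]. *)
Let E_M2 n : \int[P]_t (M n.+1 t ^+ 2) =
  \int[P]_t (M n t ^+ 2) + v * \int[P]_t D n t.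
Proof.
(* The truncation at [L] makes [g] bounded on the whole line and is the identity on the range of
   [M n]. *)
pose g (m : R) := 2 * (\1_I m * Num.max (- L) (Num.min m L)).
have gM t : g (M n t) = 2 * (D n t * M n t).
  rewrite /g; have := M_norm n t; rewrite ler_norml => /andP[L1 L2].
  by rewrite min_l// max_r.
have mg : measurable_fun setT g.
  apply: measurable_funM => //; apply: measurable_funM => //.
  by apply: measurable_maxr => //; exact: measurable_minr.
have L0 : 0 <= L by apply: le_trans (M_norm n point).
(* A single bound for [D], [g (M n)], [xi] and [xi ^+ 2]. *)
pose C := 1 + 2 * L + K + K ^+ 2.
have K2 : 0 <= K ^+ 2 by rewrite exprn_ge0.
have DC t : `|D n t| <= C.
  by have /andP[d0 d1] := D01 n t; rewrite ger0_norm// (le_trans d1)// /C; move: K0; lra.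
have gC t : `|g (M n t)| <= C.
  rewrite gM normrM ger0_norm//; apply: (@le_trans _ _ (2 * L)); last by rewrite /C; move: K0; lra.
  rewrite ler_pM2l// normrM -[L]mul1r ler_pM//.
  by have /andP[d0 d1] := D01 n t; rewrite ger0_norm.
have xiC t : `|xi n t| <= C by apply: le_trans (fK _) _; rewrite /C; lra.
have xi2C t : `|xi n t ^+ 2| <= C.
  rewrite normrX; apply: (@le_trans _ _ (K ^+ 2)); last by rewrite /C; move: K0; lra.
  by rewrite lerXn2r ?nnegrE// fK.
have E1 : \int[P]_t (g (M n t) * xi n t) = 0.
  by rewrite (E_indep (C := C))// f_mean mulr0.
have E2 : \int[P]_t (D n t * xi n t ^+ 2) = v * \int[P]_t D n t.
  rewrite (E_indep (g := \1_I) (k := fun u => f u ^+ 2) (C := C))//.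
    by rewrite f_var mulrC.
  exact: measurable_funX.
have i1 : P.-integrable setT (EFin \o (fun t => g (M n t) * xi n t)).
  apply: (@integrable_of_bound _ _ _ P _ (C * C)) => [|t].
    by apply: measurable_funM => //; exact: measurableT_comp.
  by rewrite normrM ler_pM.
have i2 : P.-integrable setT (EFin \o (fun t => D n t * xi n t ^+ 2)).
  apply: (@integrable_of_bound _ _ _ P _ (C * C)) => [|t].
    by apply: measurable_funM => //; exact: measurable_funX.
  by rewrite normrM ler_pM.
rewrite -E2 -[X in _ = X + _]addr0 -E1 -!RintegralD//; last first.
  exact: (integrableD measurableT (iM2 n) i1).
apply: eq_Rintegral => t _; rewrite MS gM DE.
by case: (_ < _ < _); rewrite ?mul1r ?mul0r; ring.
Qed.

Lemma measurable_not_exit_below N : measurable [set t | - h < M N t].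
Proof.
have -> : [set t | - h < M N t] = M N @^-1` `]- h, +oo[.
  by apply/seteqP; split => t /=; rewrite in_itv/= andbT.
by rewrite -[X in measurable X]setTI; exact: mM.
Qed.

(** Either the walk is still inside at time [N], or it was frozen at or above [b]. The probability
    [p n] of being inside decreases with [n], so [N v p(N) <= E M_N^2 <= L^2]. The other event is
    handled by Markov's inequality for [M_N + h + K], which is nonnegative with mean [h + K]. *)
Lemma not_exit_below_prob N : (0 < N)%N ->
  (P [set t | - h < M N t]%R <=
    ((h + K) / b + (h + b + K) ^+ 2 / (v * N%:R))%:E)%E.
Proof.
move=> N0; pose p n := \int[P]_t D n t.
have p_le n : p n.+1 <= p n.
  apply: le_Rintegral => // t _; rewrite !DE MS DE ler_nat.
  case: (boolP (- h < M n t < b)) => [_|/negbTE hM]; first exact: leq_b1.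
  by rewrite mul0r addr0 hM.
have p_anti n m : (n <= m)%N -> p m <= p n.
  move=> nm; rewrite -(subnKC nm); elim: (m - n)%N => [|j IH]; first by rewrite addn0.
  by rewrite addnS (le_trans (p_le _)).
have M2_ge n : (n <= N)%N -> n%:R * (v * p N) <= \int[P]_t (M n t ^+ 2).
  elim: n => [_|n IH nN]; first by rewrite mul0r Rintegral_ge0// => t _; exact: sqr_ge0.
  rewrite E_M2 -addn1 natrD mulrDl mul1r lerD ?IH 1?ltnW// ler_pM2l//.
  by apply: p_anti; exact: ltnW.
have cE r : \int[P]_t (cst r t : R) = r.
  by rewrite Rintegral_cst// [X in fine X]probability_setT mulr1.
have ic r : P.-integrable setT (EFin \o (cst r : Omega -> R)).
  exact: (@integrable_of_bound _ _ _ P _ `|r|).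
have M2_le : \int[P]_t (M N t ^+ 2) <= L ^+ 2.
  rewrite -[leRHS]cE; apply: le_Rintegral => // t _.
  rewrite -(real_normK (num_real (M N t))).
  by rewrite lerXn2r ?nnegrE// (le_trans _ (M_norm N t)).
have pN : p N <= L ^+ 2 / (v * N%:R).
  rewrite ler_pdivlMr ?mulr_gt0 ?ltr0n//.
  rewrite (_ : p N * _ = N%:R * (v * p N)); last by ring.
  exact: le_trans (M2_ge N (leqnn N)) M2_le.
have iMb : P.-integrable setT (EFin \o (fun t => b^-1 * (M N t + (h + K)))).
  exact: (integrableZl measurableT _ (integrableD measurableT (iM N) (ic (h + K)))).
have mA := measurable_not_exit_below N.
have PA : P [set t | - h < M N t] = (\int[P]_t \1_[set t | - h < M N t] t)%:E.
  rewrite /Rintegral integral_indic// setIT fineK// fin_num_measure//.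
rewrite PA lee_fin.
have -> : (h + K) / b + (h + b + K) ^+ 2 / (v * N%:R) =
    \int[P]_t (b^-1 * (M N t + cst (h + K) t)) + L ^+ 2 / (v * N%:R).
  rewrite RintegralZl//; last exact: (integrableD measurableT (iM N) (ic (h + K))).
  by rewrite RintegralD// E_M cE add0r mulrC.
apply: le_trans (lerD (lexx _) pN).
rewrite -RintegralD//; apply: le_Rintegral => //.
- apply: (@integrable_of_bound _ _ _ P _ 1) => // t.
  by rewrite indicE; case: (_ \in _); rewrite ?normr1 ?normr0.
- exact: (integrableD measurableT iMb (iD N)).
(* Pointwise, the indicator of [- h < M N] is at most [(M N + h + K) / b + D N]: the second term is
   1 inside the interval, the first is at least 1 when [M N >= b]. *)
move=> t _; rewrite indicE DE /=.
have -> : (t \in [set t | - h < M N t]) = (- h < M N t) by apply/idP/idP; rewrite inE.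
have := M_bound N t => /andP[Mh _].
have Mb : 0 <= b^-1 * (M N t + (h + K)).
  by rewrite mulr_ge0 ?invr_ge0 ?(ltW b0)// -lerBlDr sub0r.
case: (boolP (- h < M N t)) => hM; last by apply: addr_ge0.
have [bM|bM] /= := ltP (M N t) b; first by rewrite lerDr.
by rewrite addr0 mulrC ler_pdivlMr// mul1r ler_wpDr// addr_ge0.
Qed.

End exit.

(** * The random environment *)

Section log_ratio.
Context {R : realType}.
Variable eps : R.
Hypothesis eps_range : 0 < eps < 1 / 2.

(* Cutting off outside the ellipticity interval makes this bounded everywhere. *)
Definition log_ratio (u : R) : R :=
  \1_`[eps, 1 - eps] u * (ln (1 - u) - ln u).

Lemma ln_rho (u : R) : 0 < u < 1 -> ln (rho u) = ln (1 - u) - ln u.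
Proof. by move=> /andP[u0 u1]; rewrite /rho ln_div// posrE subr_gt0. Qed.

Lemma log_ratioE (u : R) : eps <= u <= 1 - eps -> log_ratio u = ln (rho u).
Proof.
move=> ue; rewrite /log_ratio indicE mem_setE in_itv/= ue mul1r ln_rho//.
by move: ue eps_range; lra.
Qed.

Lemma measurable_log_ratio : measurable_fun setT log_ratio.
Proof.
apply: measurable_funM.
  by apply: measurable_indic; exact: measurable_itv.
apply: measurable_funB; last exact: measurable_ln.
by apply: (measurableT_comp (@measurable_ln R)); exact: measurable_funB.
Qed.

Lemma log_ratio_bound (u : R) : `|log_ratio u| <= - ln eps.
Proof.
have /andP[e0 e2] := eps_range.
have le0 : ln eps <= 0 by apply: ln_le0; lra.
rewrite /log_ratio indicE mem_setE in_itv/=.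
have [/andP[u1 u2]|_] := boolP (eps <= u <= 1 - eps); last first.
  by rewrite mul0r normr0 oppr_ge0.
have lb x : eps <= x -> ln eps <= ln x by move=> ex; rewrite ler_ln ?posrE//; lra.
have ub x : eps <= x -> x <= 1 -> ln x <= 0 by move=> ex x1; apply: ln_le0.
have := lb u u1; have := ub u u1; have := lb (1 - u); have := ub (1 - u).
rewrite mul1r ler_norml; lra.
Qed.

End log_ratio.

(** * Deep valleys in almost every environment *)

Section ae_valleys.
Context {R : realType} {d : measure_display} {Omega : measurableType d}.
Variables (P : probability Omega R) (omega : int -> {RV P >-> R}).
Hypothesis omega01 : forall (x : int) (t : Omega), 0 < omega x t < 1.
Hypothesis omega_indep : mutually_independent omega.
Hypothesis omega_id : identically_distributed omega.
Variable eps0 : R.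
Hypothesis eps0_range : 0 < eps0 < 1 / 2.
Hypothesis omega_elliptic : P [set t | eps0 <= omega 0 t <= 1 - eps0] = 1%E.
Hypothesis log_rho_mean : ('E_P[fun t => ln (rho (omega 0%R t))] = 0)%E.
Hypothesis log_rho_var : (0 < 'E_P[fun t => (ln (rho (omega 0%R t)) ^+ 2)%R])%E.

Let f := log_ratio eps0.
Let K : R := - ln eps0.

Let fK u : `|f u| <= K. Proof. exact: log_ratio_bound. Qed.
Let mf : measurable_fun setT f. Proof. exact: measurable_log_ratio. Qed.

Let elliptic i := [set t | eps0 <= omega i t <= 1 - eps0].

Let elliptic_preimage i : elliptic i = omega i @^-1` `[eps0, 1 - eps0].
Proof. by apply/seteqP; split => t /=; rewrite in_itv. Qed.

Let measurable_elliptic i : measurable (elliptic i).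
Proof.
rewrite elliptic_preimage -[X in measurable X]setTI.
by apply: measurable_funP => //; exact: measurable_itv.
Qed.

Lemma ae_elliptic i : {ae P, forall t, eps0 <= omega i t <= 1 - eps0}.
Proof.
have Pi : P (elliptic i) = 1%E.
  have -> : P (elliptic i) = distribution P (omega i) `[eps0, 1 - eps0].
    by rewrite elliptic_preimage.
  rewrite (omega_id i 0); last exact: measurable_itv.
  by rewrite /distribution /pushforward -elliptic_preimage.
exists (~` elliptic i); split => //; first exact: measurableC.
by rewrite probability_setC// Pi subee.
Qed.

Let ae_log_ratio i : {ae P, forall t, f (omega i t) = ln (rho (omega i t))}.
Proof. by apply: filterS (ae_elliptic i) => t; exact: log_ratioE. Qed.

Let measurable_ln_rho : measurable_fun setT (fun t => ln (rho (omega 0 t))).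
Proof.
under eq_fun do rewrite ln_rho//.
apply: measurable_funB; last exact: (measurableT_comp (@measurable_ln R)).
by apply: (measurableT_comp (@measurable_ln R)); exact: measurable_funB.
Qed.

Let moment_id (g : R -> R) C i : measurable_fun setT g -> (forall u, `|g u| <= C) ->
  \int[P]_t g (omega i t) = \int[P]_t g (omega 0 t).
Proof.
move=> mg gC.
have int j : (\int[P]_t (g (omega j t))%:E = \int[distribution P (omega j)]_u (g u)%:E)%E.
  rewrite integral_distribution//; first exact/measurable_EFinP.
  apply: (@integrable_of_bound _ _ _ P (fun t => g (omega j t)) C) => //.
  exact: measurableT_comp.
rewrite /Rintegral !int; congr fine.
by apply: eq_measure_integral => A mA _; exact: omega_id.
Qed.

Let f_mean i : \int[P]_t f (omega i t) = 0.
Proof.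
rewrite (@moment_id f K)// /Rintegral.
rewrite (_ : (\int[P]_t (f (omega 0 t))%:E = 0)%E)//.
rewrite -log_rho_mean unlock; apply: ae_eq_integral => //.
- by apply/measurable_EFinP; exact: measurableT_comp.
- exact/measurable_EFinP.
- by apply: filterS (ae_log_ratio 0) => t /= ->.
Qed.

Let v := \int[P]_t (f (omega 0 t) ^+ 2).

Let f2K u : `|f u ^+ 2| <= K ^+ 2.
Proof. by rewrite normrX lerXn2r ?nnegrE// (le_trans _ (fK u)). Qed.

Let mf2 : measurable_fun setT (fun u => f u ^+ 2).
Proof. exact: measurable_funX. Qed.

Let f_var i : \int[P]_t (f (omega i t) ^+ 2) = v.
Proof. exact: (@moment_id (fun u => f u ^+ 2) (K ^+ 2)). Qed.

Let v_gt0 : 0 < v.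
Proof.
have mfo : measurable_fun setT (fun t => f (omega 0 t) ^+ 2).
  exact: (measurableT_comp mf2).
rewrite fine_gt0//; apply/andP; split.
  apply: (lt_le_trans log_rho_var); rewrite unlock le_eqVlt; apply/orP; left.
  apply/eqP; apply: ae_eq_integral => //.
  - by apply/measurable_EFinP; exact: measurable_funX.
  - exact/measurable_EFinP.
  - by apply: filterS (ae_log_ratio 0) => t /= ->.
(* [fine] sends an infinite value to 0, so positivity of [v] also requires a finite second moment,
   which holds because [f] is bounded. *)
have := integrable_fin_num measurableT (@integrable_of_bound _ _ _ P
  (fun t => f (omega 0 t) ^+ 2) (K ^+ 2) mfo (fun t => f2K _)).
by rewrite ltey_eq => ->.
Qed.

Let h (s : nat) : R := s%:R * ln 8.
Let b (s : nat) : R := (4 ^ s)%:R * ln 2.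
Let fail s := [set t | - h s <
  stopped_sum `]- h s, b s[ (fun i => f (omega i%:Z t)) (32 ^ s)].
Let h_ge0 s : 0 <= h s. Proof. by rewrite /h mulr_ge0 ?ln_ge0 ?ler1n. Qed.
Let b_gt0 s : 0 < b s.
Proof. by rewrite /b mulr_gt0 ?ln_gt0 ?ltr1n ?ltr0n ?expn_gt0. Qed.

Let measurable_fail s : measurable (fail s).
Proof. exact: measurable_not_exit_below. Qed.

(** With [h = O(2^s)], [b] of order [4^s] and [32^s] steps, the two terms of [not_exit_below_prob]
    are of order [2^s / 4^s] and [16^s / 32^s]. *)
Let fail_prob : exists C : R, forall s, (P (fail s) <= (C * 2^-1 ^+ s)%:E)%E.
Proof.
have l2 : 0 < ln 2 :> R by rewrite ln_gt0 ?ltr1n.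
have K0 : 0 <= K by apply: le_trans (fK 0).
exists ((3 * ln 2 + K) / ln 2 + (4 * ln 2 + K) ^+ 2 / v) => s.
have N0 : (0 < 32 ^ s)%N by rewrite expn_gt0.
apply: le_trans (not_exit_below_prob omega_indep mf fK f_mean f_var
  (h_ge0 s) (b_gt0 s) v_gt0 N0) _.
have e2 : (1 : R) <= 2 ^+ s by rewrite exprn_ege1// ler1n.
have e4 : 4 ^+ s = 2 ^+ s * 2 ^+ s :> R by rewrite -exprMn; congr (_ ^+ _); ring.
have hs : h s <= 3 * ln 2 * 2 ^+ s.
  rewrite /h (_ : 8 = 2 ^+ 3 :> R) ?lnXn//; last by ring.
  rewrite -[ln 2 *+ 3]mulr_natl mulrC ler_wpM2l ?mulr_ge0 ?(ltW l2)//.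
  by rewrite -natrX ler_nat ltnW// ltn_expl.
have bs : b s = ln 2 * (2 ^+ s * 2 ^+ s) by rewrite /b natrX e4 mulrC.
rewrite lee_fin [leRHS]mulrDl; apply: lerD.
  rewrite ler_pdivrMr// bs.
  have -> : (3 * ln 2 + K) / ln 2 * 2^-1 ^+ s * (ln 2 * (2 ^+ s * 2 ^+ s)) =
      (3 * ln 2 + K) * 2 ^+ s.
    by rewrite exprVn; field; rewrite expf_neq0// gt_eqF.
  by rewrite mulrDl lerD// ler_peMr.
rewrite ler_pdivrMr ?mulr_gt0 ?ltr0n//.
have -> : (4 * ln 2 + K) ^+ 2 / v * 2^-1 ^+ s * (v * (32 ^ s)%:R) =
    ((4 * ln 2 + K) * (2 ^+ s * 2 ^+ s)) ^+ 2.
  rewrite natrX (_ : 32 = 2 ^+ 5 :> R); last by ring.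
  rewrite exprVn -exprM mulnC exprM.
  by field; rewrite expf_neq0// gt_eqF.
rewrite lerXn2r ?nnegrE//.
- by rewrite addr_ge0// addr_ge0// ltW.
- by rewrite mulr_ge0 ?mulr_ge0 ?exprn_ge0// addr_ge0// mulr_ge0// ltW.
rewrite bs; set e := 2 ^+ s in e2 hs *.
have ee : e <= e * e by rewrite ler_peMr// (le_trans _ e2).
have : 3 * ln 2 * e <= 3 * ln 2 * (e * e) by rewrite ler_wpM2l// mulr_ge0// ltW.
have : K * 1 <= K * (e * e) by rewrite ler_wpM2l// (le_trans e2).
move: hs; lra.
Qed.

Lemma ae_deep_valley : {ae P, forall t, exists s0, forall s, (s0 <= s)%N ->
  deep_valley (potential (fun x => omega x t)) s}.
Proof.
have ae_fail : {ae P, forall t, exists s0, forall s, (s0 <= s)%N -> ~ fail s t}.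
  have [C PC] := fail_prob.
  exists (lim_sup_set fail); split.
  - apply: bigcapT_measurable => n; apply: bigcup_measurable => k _.
    exact: measurable_fail.
  - apply: lim_sup_set_cvg0 => //.
    have PE s : P (fail s) = (fine (P (fail s)))%:E by rewrite fineK// fin_num_measure.
    apply: (@le_lt_trans _ _ (\sum_(0 <= s <oo) (fine (P (fail s)))%:E)%E).
      by rewrite (eq_eseriesr (fun s _ => PE s)).
    (* The sign of [C] is not recorded, hence the absolute value. *)
    apply: (@eseries_lty _ _ (`|C| * 2)); first by move=> n; exact: fine_ge0.
    move=> n; apply: (@le_trans _ _ (\sum_(0 <= s < n) `|C| * 2^-1 ^+ s)).
      apply: ler_sum => s _; rewrite -lee_fin -PE (le_trans (PC s))// lee_fin.
      by rewrite ler_wpM2r ?ler_norm// exprn_ge0// invr_ge0.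
    by rewrite -mulr_sumr ler_wpM2l// sum_half_le.
  - move=> t /= nt n _; apply: contra_notP nt => nfail.
    by exists n => s ns failt; apply: nfail; exists s.
(* Countably many sites, hence one null set outside which the sums of [f] coincide with the
   potential. *)
have ae_ell : {ae P, forall t, forall i : nat, f (omega i t) = ln (rho (omega i t))}.
  by apply: ae_foralln => i; exact: ae_log_ratio.
apply: filterS2 ae_fail ae_ell => t [s0 nfail] fE; exists s0 => s /nfail nf.
have pE y : \sum_(1 <= i < y.+1) f (omega i%:Z t) =
    potential (fun x => omega x t) y.
  by apply: eq_bigr => i _; exact: fE.
have [|x xN [Sx Sy]] := @stopped_sum_exit_below _ (h s) (b s)
    (fun i => f (omega i%:Z t)) (32 ^ s) (b_gt0 s).
  by rewrite leNgt; apply/negP.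
by exists x => //; split => [|y yx]; rewrite -pE//; exact: Sy.
Qed.

End ae_valleys.

Theorem proposition2p1 (R : realType)
  (d : measure_display) (Omega : measurableType d) (P : probability Omega R)
  (omega : int -> {RV P >-> R})
  (omega01 : forall (x : int) (t : Omega), 0 < omega x t < 1)
  (omega_indep : mutually_independent omega)
  (omega_id : identically_distributed omega)
  (eps0 : R) (eps0_range : 0 < eps0 < 1 / 2)
  (omega_elliptic : P [set t | eps0 <= omega 0 t <= 1 - eps0] = 1%E)
  (log_rho_mean : ('E_P[fun t => ln (rho (omega 0%R t))] = 0)%E)
  (log_rho_var : (0 < 'E_P[fun t => (ln (rho (omega 0%R t)) ^+ 2)%R])%E)
  (d' : measure_display) (T : measurableType d')
  (Pq : (int -> R) -> probability T R) (Z : nat -> T -> int)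
  (Z_rwre : forall w : int -> R, (forall x : int, 0 < w x < 1) ->
     markov_chain (Pq w) (rwre_step w) 0 Z) :
  {ae P, forall t : Omega,
    (\sum_(1 <= n <oo)
       (Pq (fun x : int => omega x t) [set z | Z n z = 0%R]
        * (n%:R^-1)%:E) < +oo)%E}.
Proof.
have := ae_deep_valley omega01 omega_indep omega_id eps0_range omega_elliptic
  log_rho_mean log_rho_var.
apply: filterS => t [s0 valley].
pose w x := omega x t.
have w01 x : 0 < w x < 1 by exact: omega01.
have ZQ := Z_rwre w w01.
have mZ n : measurable [set z | Z n z = 0] by case: ZQ => + _ _; exact.
have QE n : Pq w [set z | Z n z = 0] = (fine (Pq w [set z | Z n z = 0]))%:E.
  by rewrite fineK// fin_num_measure.
under eq_eseriesr do rewrite QE -EFinM.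
(* For a fixed environment, the partial sums of the return probabilities are the Green function at
   0, and [w 0] is the constant in its bound by the potential. *)
apply: (summable_of_valleys _ _ _ valley (c := w 0)).
- by move=> n; exact: fine_ge0.
- by case/andP: (w01 0).
- by move=> N x; exact: (green_le_potential w01 ZQ).
Qed.
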